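(* Assume the whole setting described in the context: the set $\Omega$, the neighborhood $U$, the Banach spaces $\Theta,\Theta_{\rm reg},\Lambda,X,Y$, the family $\mathcal{O}$, the maps $g_\omega$, the parametrized shape functional $J$, the extension operator $E$, and the bounded linear operator $Q:X\to Y$, with all the properties listed there. Suppose that $\Omega$ is a nondegenerate critical shape for $J$ at $\lambda=0$, that is: (i) (criticality) $g_\Omega(0)=0$ on $\partial\Omega$; (ii) (nondegeneracy) the mapping $Q$ is a bijection between $X$ and $Y$. Then there exist open neighborhoods $X''$ of $0\in X$ and $\Lambda''$ of $0\in\Lambda$ and a continuous map $\Lambda''\ni\lambda\mapsto\xi(\lambda)\in X''$ such that, for every $\lambda\in\Lambda''$, the set $\omega=\Omega_{\xi(\lambda),\lambda}$ satisfies $g_{\omega}(\lambda)=0$ on $\partial\omega$. Moreover, for $(\xi,\lambda)\in X''\times\Lambda''$, the set $\omega=\Omega_{\xi,\lambda}$ satisfies $g_\omega(\lambda)=0$ on $\partial\omega$ if and only if $\xi=\xi(\lambda)$.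
   Context: Let $N\ge 2$, let $\Omega\subset\mathbb{R}^N$ be a sufficiently smooth open set with compact boundary $\partial\Omega$ and outward unit normal $n$, and let $U$ be a bounded open neighborhood of $\partial\Omega$ with sufficiently smooth boundary. Functions defined on a subset of $\mathbb{R}^N$ are identified with their extension by zero to $\mathbb{R}^N$ when there is no ambiguity. $\mathrm{Id}$ is the identity map of $\mathbb{R}^N$. Let $\Theta$ and $\Theta_{\rm reg}$ be Banach spaces of $\mathbb{R}^N$-valued functions with $$C_0^\infty(\overline U,\mathbb{R}^N)\subset\Theta_{\rm reg}\subset C_0^1(\overline U,\mathbb{R}^N)\subset\Theta\subset W_0^{1,\infty}(U,\mathbb{R}^N).$$ For $\theta\in\Theta$ put $\Omega_\theta:=(\mathrm{Id}+\theta)(\Omega)$, and let $$\mathcal{O}:=\{\Omega_\theta : \theta\in\Theta,\ \|\theta\|_{W^{1,\infty}(U,\mathbb{R}^N)}<1\}.$$ Let $m\in\mathbb{N}$, let $\Lambda$ be a Banach space (of parameters), and for every $\omega\in\mathcal{O}$ let a mapping $g_\omega:\Lambda\to L^2(\partial\omega,\mathbb{R}^m)$ be given. The free boundary problem under consideration is: for given $\lambda\in\Lambda$, find $\omega\in\mathcal{O}$ such that $g_\omega(\lambda)=0$ on $\partial\omega$. Variational assumption: for every $\omega\in\mathcal{O}$ there is an open neighborhood $\Theta'$ of $0\in\Theta$ such that $\omega_\theta:=(\mathrm{Id}+\theta)(\omega)$ is well defined for $\theta\in\Theta'$; and there is a parametrized shape functional $J:\mathcal{O}\times\Lambda\to\mathbb{R}^m$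 such that for every $\omega\in\mathcal{O}$ the map $$\mathcal{J}_\omega:\Theta'\times\Lambda\to\mathbb{R}^m,\qquad (\theta,\lambda)\mapsto J(\omega_\theta,\lambda)$$ is Fréchet differentiable and its partial Fréchet derivative with respect to the first variable satisfies $$\partial_\theta\mathcal{J}_\omega(0,\lambda)[\theta_0]=\int_{\partial\omega}g_\omega(\lambda)\ \theta_0\cdot n_\omega\qquad\text{for all }\theta_0\in\Theta,$$ where $n_\omega$ is the outward unit normal of $\partial\omega$. Extension operator: $X$ is a Banach space of real-valued functions on $\partial\Omega$, and $E:X\times\Lambda\to\Theta_{\rm reg}$ is Fréchet differentiable and such that $E(\cdot,0):X\to\Theta_{\rm reg}$ is a bounded linear operator with $E(\xi,0)|_{\partial\Omega}=\xi n$ for all $\xi\in X$. Regularity assumption: $Y\subset L^2(\partial\Omega,\mathbb{R}^m)$ is a Banach space, and there are open neighborhoods $\Theta'_{\rm reg}$ of $0\in\Theta_{\rm reg}$ and $\Lambda'$ of $0\in\Lambda$ such that the mapping $(\theta,\lambda)\mapsto g_{\Omega_\theta}(\lambda)\circ(\mathrm{Id}+\theta)\in Y$ is Fréchet differentiable in a neighborhood of $(0,0)\in\Theta'_{\rm reg}\times\Lambda'$. For small $(\xi,\lambda)\in X\times\Lambda$ set $\Omega_{\xi,\lambda}:=\Omega_{E(\xi,\lambda)}=(\mathrm{Id}+E(\xi,\lambda))(\Omega)$. The operator $Q$: for a small neighborhood $X'$ of $0\in X$, let $$j:X'\times\Lambda'\to\mathbb{R}^m,\quad j(\xi,\lambda):=J(\Omega_{\xi,\lambda},\lambda),\qquad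 h:X'\times\Lambda'\to Y,\quad h(\xi,\lambda):=g_{\Omega_{\xi,\lambda}}(\lambda)\circ(\mathrm{Id}+E(\xi,\lambda)).$$ The bounded linear operator $Q:X\to Y$ is $Q:=\partial_x h(0,0)$, the partial Fréchet derivative of $h$ with respect to the first variable at $(0,0)$; when $g_\Omega(0)=0$ it represents the second derivative of $j$, in the sense that $$\partial^2_{xx}j(0,0)[\xi,\eta]=\int_{\partial\Omega}Q(\xi)\,\eta\qquad\text{for all }\xi,\eta\in X.$$
   Formalization: E and the map (θ,λ) ↦ g_{Ω_θ}(λ)∘(Id+θ) are assumed continuously Fréchet differentiable near the origin, since uniqueness fails under mere Fréchet differentiability; the inclusions among Θ_reg, C_0^1, Θ and W_0^{1,∞} are taken to be continuous. *)

(* Defs.v *)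
From HB Require Import structures.
From mathcomp Require Import all_boot all_order all_algebra.
From mathcomp Require Import all_classical all_reals all_analysis.

Set Implicit Arguments.
Unset Strict Implicit.
Unset Printing Implicit Defensive.

Import Order.TTheory GRing.Theory Num.Theory.
Import numFieldNormedType.Exports.

Local Open Scope classical_set_scope.
Local Open Scope ring_scope.

(** ** Euclidean structure of R^N, and differentiability classes *)

(* The library norm on ['rV[R]_N] is the sup norm: it gives the right topology
   but not the Euclidean lengths needed for normals and Hausdorff measures. *)
Definition dotv (R : realType) (N : nat) (u v : 'rV[R]_N) : R :=
  \sum_(i < N) u 0 i * v 0 i.

Definition enorm (R : realType) (N : nat) (u : 'rV[R]_N) : R :=
  Num.sqrt (dotv u u).

Definition bdry (T : topologicalType) (A : set T) : set T :=
  closure A `\` interior A.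

(* On a finite-dimensional [V] this is the usual class C^k. *)
Fixpoint Ck (R : realType) (V W : normedModType R) (k : nat) (f : V -> W)
    : Prop :=
  if k is k'.+1 then
    (forall x, differentiable f x) /\ (forall v, Ck k' ('D_v f))
  else continuous f.

Definition Cinfty (R : realType) (V W : normedModType R) (f : V -> W) : Prop :=
  forall k, Ck k f.

(* [f] is Frechet differentiable near [p], with a derivative that is
   continuous near [p] for the operator norm. *)
Definition C1_near (R : realType) (V W : normedModType R) (f : V -> W) (p : V)
    : Prop :=
  \forall q \near p, differentiable f q /\
    forall e : R, 0 < e ->
      \forall r \near q, forall v : V, `|'d f r v - 'd f q v| <= e * `|v|.

(** ** Hausdorff measure *)

(* All subsets of [T] are declared measurable, so that the library's outer
   measure [mu_ext] ranges over coverings by arbitrary sets. *)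
Definition all_sets (T : Type) : Type := T.

Section AllSets.
Variable T : pointedType.
HB.instance Definition _ := Pointed.on (all_sets T).
HB.instance Definition _ := @isMeasurable.Build default_measure_display
  (all_sets T) [set: set T] I (fun _ _ => I) (fun _ _ => I).
End AllSets.

(* Volume of the unit ball of R^k. *)
Fixpoint ball_volume (R : realType) (k : nat) : R :=
  match k with
  | 0 => 1
  | 1 => 2
  | k'.+2 => 2 * pi / k%:R * ball_volume R k'
  end.

Section Hausdorff.
Context {R : realType} {N : nat}.
Local Open Scope ereal_scope.

Definition diam (A : set 'rV[R]_N) : \bar R :=
  ereal_sup [set (enorm (x - y)%R)%:E | x in A & y in A].

Definition hausdorff_gauge (k : nat) (delta : R) (A : set 'rV[R]_N) : \bar R :=
  if A == set0 then 0
  else if diam A <= delta%:E then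
    (ball_volume R k * (fine (diam A) / 2) ^+ k)%R%:E
  else +oo.

Definition hausdorff_pre (k : nat) (delta : R) (A : set 'rV[R]_N) : \bar R :=
  mu_ext (hausdorff_gauge k delta : set (all_sets 'rV[R]_N) -> \bar R) A.

(* Normalized so that it is the Lebesgue measure for [k = N], and the surface
   measure on C^1 (and Lipschitz) hypersurfaces for [k = N.-1]. *)
Definition hausdorff (k : nat) (A : set 'rV[R]_N) : \bar R :=
  ereal_sup [set hausdorff_pre k delta A | delta in [set d : R | (0 < d)%R]].

Lemma hausdorff_gauge0 k delta : hausdorff_gauge k delta set0 = 0.
Proof. by rewrite /hausdorff_gauge eqxx. Qed.

Lemma ball_volume_ge0 k : (0 <= ball_volume R k)%R.
Proof.
suff : (0 <= ball_volume R k)%R /\ (0 <= ball_volume R k.+1)%R by case.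
elim: k => [|k [IH0 IH1]]; first by split => /=; rewrite ?ler01 ?ler0n.
split=> //; rewrite [ball_volume R k.+2]/=.
by rewrite !mulr_ge0 ?invr_ge0 ?ler0n ?pi_ge0.
Qed.

Lemma hausdorff_gauge_ge0 k delta A : 0 <= hausdorff_gauge k delta A.
Proof.
rewrite /hausdorff_gauge; case: (eqVneq A set0) => // /set0P[x Ax].
case: ifP => _; last exact: leey.
rewrite lee_fin mulr_ge0 ?ball_volume_ge0// exprn_ge0// divr_ge0//.
apply: fine_ge0; apply: (@le_trans _ _ (enorm (x - x)%R)%:E).
  by rewrite lee_fin sqrtr_ge0.
by apply: ereal_sup_ubound; exists x => //; exists x.
Qed.

Lemma hausdorff_pre_le k delta A : (0 < delta)%R ->
  hausdorff_pre k delta A <= hausdorff k A.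
Proof. by move=> d0; apply: ereal_sup_ubound; exists delta. Qed.

Lemma hausdorff_pre_ge0 k delta A : 0 <= hausdorff_pre k delta A.
Proof. exact/mu_ext_ge0/hausdorff_gauge_ge0. Qed.

Lemma hausdorff0 k : hausdorff k set0 = 0.
Proof.
apply/eqP; rewrite eq_le; apply/andP; split.
  apply: ge_ereal_sup => _ [d _ <-]; rewrite /hausdorff_pre mu_ext0//.
    exact: hausdorff_gauge0.
  exact: hausdorff_gauge_ge0.
exact: le_trans (hausdorff_pre_ge0 k 1 _) (hausdorff_pre_le _ _ ltr01).
Qed.

Lemma hausdorff_ge0 k A : 0 <= hausdorff k A.
Proof.
exact: le_trans (hausdorff_pre_ge0 k 1 _) (hausdorff_pre_le _ _ ltr01).
Qed.

Lemma le_hausdorff k : {homo hausdorff k : A B / A `<=` B >-> A <= B}.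
Proof.
move=> A B AB; apply: ge_ereal_sup => _ [d d0 <-].
apply: le_trans (hausdorff_pre_le k B d0).
exact: le_mu_ext.
Qed.

Lemma hausdorff_sigma_subadditive k : sigma_subadditive (hausdorff k).
Proof.
move=> F; apply: ge_ereal_sup => _ [d d0 <-].
apply: (@le_trans _ _ (\sum_(i <oo) hausdorff_pre k d (F i))).
  exact/mu_ext_sigma_subadditive/hausdorff_gauge_ge0.
by apply: lee_nneseries => n *; [exact: hausdorff_pre_ge0|exact: hausdorff_pre_le].
Qed.

HB.instance Definition _ k := isOuterMeasure.Build R 'rV[R]_N (hausdorff k)
  (hausdorff0 k) (hausdorff_ge0 k) (@le_hausdorff k)
  (@hausdorff_sigma_subadditive k).

End Hausdorff.

Arguments hausdorff {R N} k A.

(* R^N with the sigma-algebra of Caratheodory-measurable sets of the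
   k-dimensional Hausdorff outer measure; it contains the Borel sets, and
   [hausdorff k] is a complete measure on it. *)
Definition hausdorff_outer (R : realType) (N k : nat)
    : {outer_measure set 'rV[R]_N -> \bar R} := @hausdorff R N k.

Notation hspace R N k := (caratheodory_type (hausdorff_outer R N k)).

Definition hmeasure (R : realType) (N k : nat)
    : {measure set (hspace R N k) -> \bar R} :=
  hausdorff_outer R N k : set (hspace R N k) -> \bar R.

(* [N.-1] is the dimension of boundaries in R^N. *)
Definition surf_ae (R : realType) (N : nat) (A : set 'rV[R]_N)
    (P : 'rV[R]_N -> Prop) : Prop :=
  {ae @hmeasure R N N.-1, forall x, A x -> P x}.

Definition surf_int (R : realType) (N : nat) (A : set 'rV[R]_N)
    (f : 'rV[R]_N -> R) : R :=
  (\int[@hmeasure R N N.-1]_(x in A) f x)%R.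

(* [f] is (a representative of) an element of L^2(A, R^m), where [A] carries the
   surface measure. *)
Definition L2_on (R : realType) (N m : nat) (A : set 'rV[R]_N)
    (f : 'rV[R]_N -> 'rV[R]_m) : Prop :=
  forall i : 'I_m,
    measurable_fun (A : set (hspace R N N.-1))
                   (fun x : hspace R N N.-1 => f x 0 i) /\
    (@hmeasure R N N.-1).-integrable A (fun x => ((f x 0 i) ^+ 2)%:E).

(** ** Domains, normals and deformations *)

(* Near each boundary point, [D] is the sublevel set of a C^1 function with
   nonzero gradient. *)
Definition C1_domain (R : realType) (N : nat) (D : set 'rV[R]_N) : Prop :=
  open D /\
  forall x, bdry D x ->
    exists rho : 'rV[R]_N -> R,
      [/\ Ck 1 rho, (exists v, 'D_v rho x != 0)
        & \forall y \near x, D y <-> rho y < 0].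

(* Elements of the family O are merely images of a C^1 domain by bi-Lipschitz
   maps, so the normal must make sense almost everywhere on such sets: [n] is the
   outward unit normal of [D] at [x] when, for every aperture, near [x] the cone
   around [-n] lies in [D] and the cone around [n] lies outside [D].  Such an [n]
   is unique, and on C^1 domains it is the usual normal. *)
Definition is_outward_normal (R : realType) (N : nat) (D : set 'rV[R]_N)
    (x n : 'rV[R]_N) : Prop :=
  [/\ bdry D x, enorm n = 1
    & forall e : R, 0 < e -> \forall y \near x,
        (dotv (y - x) n < - (e * enorm (y - x)) -> D y) /\
        (e * enorm (y - x) < dotv (y - x) n -> ~ D y)].

Definition normal (R : realType) (N : nat) (D : set 'rV[R]_N) (x : 'rV[R]_N)
    : 'rV[R]_N :=
  xget 0 [set n | is_outward_normal D x n].

Definition deform (R : realType) (N : nat) (theta : 'rV[R]_N -> 'rV[R]_N)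
    (D : set 'rV[R]_N) : set 'rV[R]_N :=
  [set x + theta x | x in D].

(** ** Function spaces; functions are extended by zero to R^N *)

(* C_0^k(closure U, R^N): the C^k functions on R^N with support in the compact
   set [closure U]. *)
Definition C0k (R : realType) (N k : nat) (U : set 'rV[R]_N)
    (f : 'rV[R]_N -> 'rV[R]_N) : Prop :=
  Ck k f /\ forall x, ~ closure U x -> f x = 0.

Definition C0infty (R : realType) (N : nat) (U : set 'rV[R]_N)
    (f : 'rV[R]_N -> 'rV[R]_N) : Prop :=
  forall k, C0k k U f.

(* max (sup |f|, sup |Df|), with the operator norm on Df. *)
Definition C1_norm (R : realType) (N : nat) (f : 'rV[R]_N -> 'rV[R]_N) : R :=
  sup [set r | exists x, r = enorm (f x) \/
                 exists2 v, enorm v <= 1 & r = enorm ('D_v f x)].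

Definition test_function (R : realType) (N : nat) (U : set 'rV[R]_N)
    (phi : 'rV[R]_N -> R) : Prop :=
  Cinfty phi /\
  exists K, [/\ compact K, K `<=` U & forall x, ~ K x -> phi x = 0].

(* [D x i j] is the weak partial derivative of [f_j] in direction [i], so that
   the derivative of [f] along [v] is [v *m D x]. *)
Definition weak_jacobian (R : realType) (N : nat) (U : set 'rV[R]_N)
    (f : 'rV[R]_N -> 'rV[R]_N) (D : 'rV[R]_N -> 'M[R]_N) : Prop :=
  forall (i j : 'I_N),
    measurable_fun (U : set (hspace R N N)) (fun x : hspace R N N => D x i j) /\
    forall phi, test_function U phi ->
      (\int[@hmeasure R N N]_(x in U) (f x 0 j * 'D_(delta_mx 0 i) phi x) =
       - \int[@hmeasure R N N]_(x in U) (D x i j * phi x))%R.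

Definition W1inf_bound (R : realType) (N : nat) (U : set 'rV[R]_N)
    (f : 'rV[R]_N -> 'rV[R]_N) (M : R) : Prop :=
  0 <= M /\
  exists D, weak_jacobian U f D /\
    {ae @hmeasure R N N, forall x, U x ->
       enorm (f x) <= M /\ forall v, enorm (v *m D x) <= M * enorm v}.

(* max (ess sup |f|, ess sup |Df|), with the operator norm on Df. *)
Definition W1inf_norm (R : realType) (N : nat) (U : set 'rV[R]_N)
    (f : 'rV[R]_N -> 'rV[R]_N) : R :=
  inf [set M | W1inf_bound U f M].

(* W_0^{1,infty}(U, R^N), each element being identified with its continuous
   representative. *)
Definition W01inf (R : realType) (N : nat) (U : set 'rV[R]_N)
    (f : 'rV[R]_N -> 'rV[R]_N) : Prop :=
  [/\ continuous f, (forall x, ~ U x -> f x = 0)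
    & exists M, W1inf_bound U f M].

(* A Banach space of functions from [A] to [V]. *)
Record banach_fun_space (R : realType) (N : nat) (A : set 'rV[R]_N)
    (V : lmodType R) := BanachFunSpace {
  fs_space :> completeNormedModType R;
  fs_eval : fs_space -> 'rV[R]_N -> V;
  fs_evalP : forall (a : R) (f g : fs_space) (x : 'rV[R]_N),
    fs_eval (a *: f + g) x = a *: fs_eval f x + fs_eval g x;
  fs_eval_inj : injective fs_eval;
  fs_eval_out : forall (f : fs_space) (x : 'rV[R]_N), ~ A x -> fs_eval f x = 0 }.

(* A Banach space contained in L^2(A, R^m); [l2_repr] picks representatives. *)
Record banach_L2_space (R : realType) (N m : nat) (A : set 'rV[R]_N) :=
  BanachL2Space {
  l2_space :> completeNormedModType R;
  l2_repr : l2_space -> 'rV[R]_N -> 'rV[R]_m;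
  l2_reprL2 : forall f : l2_space, L2_on A (l2_repr f);
  l2_reprP : forall (a : R) (f g : l2_space),
    surf_ae A (fun x => l2_repr (a *: f + g) x = a *: l2_repr f x + l2_repr g x);
  l2_repr_inj : forall f g : l2_space,
    surf_ae A (fun x => l2_repr f x = l2_repr g x) -> f = g }.

(* C_0^infty <= Theta_reg <= C_0^1 <= Theta <= W_0^{1,infty} on [U]; the
   inclusions between normed spaces are continuous. *)
Definition deformation_spaces (R : realType) (N : nat) (U : set 'rV[R]_N)
    (Theta Theta_reg : banach_fun_space (closure U) 'rV[R]_N) : Prop :=
  [/\ (forall f, C0infty U f -> exists t : Theta_reg, fs_eval t = f),
      (forall t : Theta_reg, C0k 1 U (fs_eval t)) /\
      (exists C : R, forall t : Theta_reg, C1_norm (fs_eval t) <= C * `|t|),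
      (forall f, C0k 1 U f -> exists t : Theta, fs_eval t = f) /\
      (exists C : R, forall t : Theta,
         C0k 1 U (fs_eval t) -> `|t| <= C * C1_norm (fs_eval t))
    & (forall t : Theta, W01inf U (fs_eval t)) /\
      (exists C : R, forall t : Theta, W1inf_norm U (fs_eval t) <= C * `|t|)].

(* The family O of admissible sets. *)
Definition admissible (R : realType) (N : nat) (U : set 'rV[R]_N)
    (Theta : banach_fun_space (closure U) 'rV[R]_N) (Omega : set 'rV[R]_N)
    : set (set 'rV[R]_N) :=
  [set omega | exists t : Theta,
     W1inf_norm U (fs_eval t) < 1 /\ omega = deform (fs_eval t) Omega].

(** ** The free boundary problem *)

(* The maps [g omega lam] (a representative of an L^2 class on the boundary of
   [omega]) and [J omega lam] are only meaningful for admissible [omega]; their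
   values elsewhere are never used. *)

Definition vanishes_on_bdry (R : realType) (N m : nat) (omega : set 'rV[R]_N)
    (f : 'rV[R]_N -> 'rV[R]_m) : Prop :=
  surf_ae (bdry omega) (fun x => f x = 0).

Definition variational_assumption (R : realType) (N m : nat)
    (U : set 'rV[R]_N) (Theta : banach_fun_space (closure U) 'rV[R]_N)
    (Omega : set 'rV[R]_N) (Lam : completeNormedModType R)
    (g : set 'rV[R]_N -> Lam -> 'rV[R]_N -> 'rV[R]_m)
    (J : set 'rV[R]_N -> Lam -> 'rV[R]_m) : Prop :=
  forall omega, admissible Theta Omega omega ->
    exists Theta' : set Theta,
      [/\ open_nbhs (0 : Theta) Theta',
          (forall t, Theta' t -> admissible Theta Omega (deform (fs_eval t) omega)),
          (forall t lam, Theta' t ->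
             differentiable
               (fun p : Theta * Lam => J (deform (fs_eval p.1) omega) p.2)
               (t, lam))
        & forall (lam : Lam) (t0 : Theta),
            'd (fun t : Theta => J (deform (fs_eval t) omega) lam) (0 : Theta) t0 =
            \row_(i < m) surf_int (bdry omega)
              (fun x => g omega lam x 0 i *
                        dotv (fs_eval t0 x) (normal omega x))].

(* Besides the Frechet differentiability of [E], its derivative is continuous
   near the origin. *)
Definition extension_operator (R : realType) (N : nat)
    (U Omega : set 'rV[R]_N)
    (Theta_reg : banach_fun_space (closure U) 'rV[R]_N)
    (Lam : completeNormedModType R)
    (X : banach_fun_space (bdry Omega) (R^o)) (E : X * Lam -> Theta_reg)
    : Prop :=
  [/\ (forall p, differentiable E p) /\ C1_near E (0, 0),
      linear (fun xi : X => E (xi, 0)),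
      (exists C : R, forall xi : X, `|E (xi, 0)| <= C * `|xi|)
    & forall (xi : X) x, bdry Omega x ->
        fs_eval (E (xi, 0)) x = (fs_eval xi x : R) *: normal Omega x].

(* [G (theta, lam)] is g_{Omega_theta}(lam) o (Id + theta), seen in [Y]. *)
Definition regularity_assumption (R : realType) (N m : nat)
    (U Omega : set 'rV[R]_N)
    (Theta Theta_reg : banach_fun_space (closure U) 'rV[R]_N)
    (Lam : completeNormedModType R)
    (g : set 'rV[R]_N -> Lam -> 'rV[R]_N -> 'rV[R]_m)
    (Y : banach_L2_space m (bdry Omega))
    (Theta_reg' : set Theta_reg) (Lam' : set Lam) (G : Theta_reg * Lam -> Y)
    : Prop :=
  [/\ open_nbhs (0 : Theta_reg) Theta_reg', open_nbhs (0 : Lam) Lam',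
      (forall t lam, Theta_reg' t -> Lam' lam ->
         admissible Theta Omega (deform (fs_eval t) Omega) /\
         surf_ae (bdry Omega) (fun x =>
           l2_repr (G (t, lam)) x =
           g (deform (fs_eval t) Omega) lam (x + fs_eval t x)))
    & C1_near G (0, 0)].

(* Main.v *)
(* The map h is continuously differentiable near (0, 0), its partial derivative Q
   is bijective, hence an isomorphism by the open mapping theorem, and
   h(0, 0) = 0 by criticality, so the implicit function theorem describes the
   zeros of h near (0, 0) as the graph of a Lipschitz map lambda |-> xi(lambda).
   The zeros of h are the solutions of the free boundary problem: for small theta
   in C^1, the map Id + theta is a bi-Lipschitz homeomorphism of R^N, so it maps
   the boundary of Omega onto that of Omega_theta and preserves the null sets of
   the surface measure in both directions. *)

Require Import Defs.
From HB Require Import structures.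
From mathcomp Require Import all_boot all_order all_algebra.
From mathcomp Require Import all_classical all_reals all_analysis.
From mathcomp Require Import ring lra.
Import Order.TTheory GRing.Theory Num.Theory.
Import numFieldNormedType.Exports.
Local Open Scope classical_set_scope.
Local Open Scope ring_scope.

Set Implicit Arguments.
Unset Strict Implicit.
Unset Printing Implicit Defensive.

(** * Mean value inequalities in normed spaces *)

Lemma subrACA (V : zmodType) (x y z t : V) : x - y - (z - t) = x - z - (y - t).
Proof. by rewrite !opprB addrACA [RHS]addrACA [- y - _]addrC. Qed.

(* A supremum argument on [0, 1], which replaces the reduction to the scalar mean
   value theorem by linear forms and the Hahn-Banach theorem. *)
Lemma local_growth_bound (R : realType) (W : normedModType R) (psi : R -> W)
    (M : R) :
  (forall t : R, 0 <= t <= 1 -> forall e : R, 0 < e ->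
     \forall s \near t, `|psi s - psi t| <= (M + e) * `|s - t|) ->
  `|psi 1 - psi 0| <= M.
Proof.
move=> growth; apply/ler_addgt0Pr => e e0.
(* The supremum [c] of [S] belongs to [S], by comparison with an element of [S] close to [c]; if
   [c < 1], the growth estimate at [c] carries the bound past [c]. *)
pose S := [set t : R | 0 <= t <= 1 /\ `|psi t - psi 0| <= (M + e) * t].
have S0 : S 0 by split; rewrite ?lexx ?ler01// subrr normr0 mulr0.
have supS : has_sup S.
  by split; [exists 0|exists 1 => t [/andP[]]].
pose c := sup S.
have c01 : 0 <= c <= 1.
  apply/andP; split; first by apply: ub_le_sup S0; case: supS.
  by apply: ge_sup; [exists 0|move=> t [/andP[]]].
have [d d0 nearc] : exists2 d, 0 < d & forall s, `|s - c| < d ->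
    `|psi s - psi c| <= (M + e) * `|s - c|.
  have /nbhs_normP[d d0 dP] := growth c c01 e e0.
  by exists d => // s sc; apply: dP; rewrite /= distrC.
have Sc : S c.
  split=> //; have [t St tc] := sup_adherent d0 supS.
  have tlec : t <= c by apply: ub_le_sup St; case: supS.
  have : `|t - c| < d by rewrite distrC ger0_norm ?subr_ge0// ltrBlDl -ltrBlDr.
  move=> /nearc; rewrite distrC [in X in _ * X]distrC => H.
  have -> : psi c - psi 0 = (psi c - psi t) + (psi t - psi 0).
    by rewrite addrA subrK.
  rewrite (le_trans (ler_normD _ _))// (le_trans (lerD H St.2))//.
  by rewrite ger0_norm ?subr_ge0// -mulrDr subrK.
have [c1|c1] := ltP c 1; last first.
  have <- : c = 1 by apply/le_anti; rewrite c1; case/andP: c01 => _ ->.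
  move: Sc => [_]; rewrite (_ : c = 1) ?mulr1//.
  by apply/le_anti; rewrite c1; case/andP: c01 => _ ->.
exfalso; pose s := Num.min 1 (c + d / 2).
have cs : c < s by rewrite lt_min c1/= ltrDl divr_gt0.
suff : S s by move=> /(ub_le_sup supS.2); rewrite leNgt cs.
have s0 : 0 <= s by apply: le_trans (ltW cs); case/andP: c01.
split; first by rewrite s0 ge_min lexx.
have : `|s - c| < d.
  rewrite gtr0_norm ?subr_gt0// ltrBlDl gt_min; apply/orP; right.
  by rewrite ltrD2l ltr_pdivrMr// ltr_pMr// ltr1n.
move=> /nearc H; rewrite -(subrK (psi c) (psi s)) -addrA.
rewrite (le_trans (ler_normD _ _))// (le_trans (lerD H Sc.2))//.
by rewrite gtr0_norm ?subr_gt0// -mulrDr subrK.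
Qed.

Lemma differentiable_near (R : realType) (V W : normedModType R) (f : V -> W)
    (x : V) : differentiable f x -> forall e : R, 0 < e ->
  \forall y \near x, `|f y - f x - 'd f x (y - x)| <= e * `|y - x|.
Proof.
move=> /diffP[_ dfx] e e0.
have /eqaddoP/(_ e e0) := funext dfx.
rewrite lim_id//.
apply: filterS => y /=.
by rewrite -[X in `|X|]/(f y - (f x + 'd f x (y - x))) opprD addrA.
Qed.

(** The restriction of [f] to the segment satisfies the hypothesis of [local_growth_bound]: the
    linear part of an increment contributes [M], the remainder any prescribed [e]. *)
Lemma mean_value_segment (R : realType) (V W : normedModType R) (f : V -> W)
    (x y : V) (M : R) :
  (forall t : R, 0 <= t <= 1 -> differentiable f (x + t *: (y - x)) /\
     `|'d f (x + t *: (y - x)) (y - x)| <= M) ->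
  `|f y - f x| <= M.
Proof.
move=> df; pose psi (t : R) := f (x + t *: (y - x)).
suff : `|psi 1 - psi 0| <= M by rewrite /psi scale1r scale0r addr0 subrKC.
apply: local_growth_bound => t t01 e e0; have [dft dM] := df t t01.
set z := x + t *: (y - x) in dft dM *; set v := y - x in z dft dM *.
(* Adding 1 avoids a division by zero when [v = 0]. *)
have v1 : 0 < `|v| + 1 by rewrite ltr_wpDl.
have := differentiable_near dft (divr_gt0 e0 v1).
move=> /nbhs_normP[d d0 dP].
apply/nbhs_normP; exists (d / (`|v| + 1)); first by rewrite /= divr_gt0.
move=> s /=; rewrite distrC ltr_pdivlMr// => st.
have zs : x + s *: v - z = (s - t) *: v.
  by rewrite opprD addrACA subrr add0r -scalerBl.
have : `|f (x + s *: v) - f z - 'd f z ((s - t) *: v)| <=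
    e / (`|v| + 1) * `|(s - t) *: v|.
  rewrite -zs; apply: dP => /=; rewrite distrC zs normrZ.
  by apply: le_lt_trans st; rewrite ler_wpM2l// lerDl.
rewrite linearZ/= !normrZ => H.
rewrite -[psi s - psi t](subrK ((s - t) *: 'd f z v)).
rewrite (le_trans (ler_normD _ _))// mulrDl addrC lerD//.
  by rewrite normrZ mulrC ler_wpM2r.
apply: (le_trans H); rewrite mulrAC ler_pdivrMr// mulrA.
by rewrite ler_wpM2l ?mulr_ge0 ?(ltW e0)// lerDl.
Qed.

Lemma mean_value_linear (R : realType) (V W : normedModType R) (f : V -> W)
    (L : {linear V -> W}) (x y : V) (e : R) : continuous L ->
  (forall t : R, 0 <= t <= 1 -> differentiable f (x + t *: (y - x)) /\
     forall v, `|'d f (x + t *: (y - x)) v - L v| <= e * `|v|) ->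
  `|f y - f x - L (y - x)| <= e * `|y - x|.
Proof.
move=> cL df; have dL z := linear_differentiable z cL.
have -> : f y - f x - L (y - x) = (f - (L : V -> W)) y - (f - (L : V -> W)) x.
  by rewrite linearB/= subrACA.
apply: mean_value_segment => t t01; have [dft dM] := df t t01.
split; first exact: differentiableB.
by rewrite diffB// diff_lin//; exact: dM.
Qed.

(** * Bounded inverses of continuous linear bijections *)

(* By Baire's theorem, the closure of the image of some ball contains a ball. *)
Lemma surjective_approx_preimage (R : realType) (X : normedModType R)
    (Y : completeNormedModType R) (L : {linear X -> Y}) :
  (forall y, exists x, L x = y) ->
  exists2 M : R, 0 <= M & forall y, exists2 x, `|x| <= M * `|y| &
    `|y - L x| <= `|y| / 2.
Proof.
move=> surjL.
(* If all these open sets were dense, some [y] would avoid every closure, although [y = L x] with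
   [x] in one of the balls. *)
pose O (n : nat) := ~` closure (L @` [set x | `|x| <= n%:R]).
have [i ndense] : exists i, ~ dense (O i).
  apply/not_existsP => /(_ _)/contrapT dO.
  have /Baire dcap : forall i, open (O i) /\ dense (O i).
    by move=> i; split; [exact/closed_openC/closed_closure|exact: dO].
  have [y [_ Oy]] := dcap setT (ex_intro _ 0 I) openT.
  have [x Lx] := surjL y.
  apply: (Oy (Num.truncn `|x|).+1 I); apply: subset_closure; exists x => //=.
  exact/ltW/truncnS_gt.
have [D [[y0 /open_nbhs_nbhs/nbhs_normP[r /= r0 ballD]] disj]] := denseNE ndense.
have near_closure z : `|y0 - z| < r -> exists2 x, `|x| <= i%:R &
    `|z - L x| < r / 8.
  move=> /ballD Dz.
  have : closure (L @` [set x | `|x| <= i%:R]) z.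
    apply: contrapT => Oz.
    by have : (D `&` O i) z by []; rewrite disj.
  have : nbhs z (ball_ Num.norm z (r / 8)).
    by apply/nbhs_normP; exists (r / 8) => //=; rewrite divr_gt0.
  by move=> nz /(_ _ nz)[_ [[x xi <-] zx]]; exists x.
have r2 : r != 0 by rewrite gt_eqF.
exists (4 * i%:R / r); first by rewrite divr_ge0 ?mulr_ge0 ?ler0n// ltW.
move=> y; have [->|yN0] := eqVneq y 0.
  by exists 0; [rewrite !normr0 mulr0|rewrite linear0 subr0 !normr0 mul0r].
have ny : 0 < `|y| by rewrite normr_gt0.
(* With this scaling [c^-1 *: y] has norm [r / 2], so [y0 + c^-1 *: y] stays in the ball.
   Subtracting an approximation of [y0] removes the centre, and two errors [r / 8] scale back to
   half the norm of [y]. *)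
pose c := 2 * `|y| / r; have c0 : 0 < c by rewrite divr_gt0 ?mulr_gt0.
have cN0 : c != 0 by rewrite gt_eqF.
have [x1 x1i Lx1] : exists2 x, `|x| <= i%:R & `|(y0 + c^-1 *: y) - L x| < r / 8.
  apply: near_closure; rewrite opprD addrA subrr add0r normrN normrZ.
  rewrite gtr0_norm ?invr_gt0//.
  have -> : c^-1 * `|y| = r / 2 by rewrite /c; field; rewrite r2 normr_eq0 yN0.
  by rewrite ltr_pdivrMr// ltr_pMr// ltr1n.
have [x2 x2i Lx2] : exists2 x, `|x| <= i%:R & `|y0 - L x| < r / 8.
  by apply: near_closure; rewrite subrr normr0.
exists (c *: (x1 - x2)).
  rewrite normrZ gtr0_norm//.
  have -> : 4 * i%:R / r * `|y| = c * (i%:R + i%:R) by rewrite /c; field.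
  by rewrite ler_wpM2l ?(ltW c0)// (le_trans (ler_normB _ _))// lerD.
have -> : y - L (c *: (x1 - x2)) =
    c *: (((y0 + c^-1 *: y) - L x1) - (y0 - L x2)).
  have cancel4 (a b c' d : Y) : a + b - c' - (a - d) = b - (c' - d).
    by rewrite !opprB -[a + b - c']addrA [LHS]addrC addrA subrK addrCA.
  by rewrite cancel4 [RHS]scalerBr scalerA mulfV// scale1r linearZ/=
             linearB.
rewrite normrZ gtr0_norm//.
have -> : `|y| / 2 = c * (r / 8 + r / 8) by rewrite /c; field.
by rewrite ler_wpM2l ?(ltW c0)// (le_trans (ler_normB _ _))// lerD// ltW.
Qed.

(* The preimage of [L x] is the sum of the series of successive corrections. *)
Lemma bijective_linear_bounded_below (R : realType)
    (X Y : completeNormedModType R) (L : {linear X -> Y}) :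
  continuous L -> bijective L ->
  exists2 C : R, 0 < C & forall x, `|x| <= C * `|L x|.
Proof.
move=> cL [Linv LK KL].
have [|M M0 approx] := @surjective_approx_preimage _ X Y L.
  by move=> y; exists (Linv y).
have /choice[s sP] : forall y, exists x, `|x| <= M * `|y| /\ `|y - L x| <= `|y| / 2.
  by move=> y; have [x xM xy] := approx y; exists x.
(* The geometric series of corrections contributes [2 * M]; the added 1 makes the constant
   positive. *)
exists (2 * M + 1); first by rewrite ltr_wpDl ?mulr_ge0.
(* [y n] is the residual left after [n] corrections, each of which at least halves it. *)
move=> x; pose y n := iter n (fun z => z - L (s z)) (L x).
pose u n := s (y n).
have yle n : `|y n| <= `|L x| / 2 ^+ n.
  elim: n => [|n IH]; first by rewrite expr0 divr1.
  apply: (le_trans (sP (y n)).2); rewrite exprSr invfM mulrA.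
  by rewrite ler_wpM2r ?invr_ge0.
have uy n : L (series u n) = L x - y n.
  elim: n => [|n IH]; first by rewrite /series/= big_geq// linear0 subrr.
  by rewrite seriesSr linearD/= IH /u opprB addrA addrAC.
pose v := series (fun n => `|u n|).
(* The last factor comes from the exact partial geometric sum, which lets the induction close. *)
have nle n : v n <= 2 * M * `|L x| * (1 - 1 / 2 ^+ n).
  elim: n => [|n IH].
    by rewrite /v /series/= big_geq// expr0 divr1 subrr mulr0.
  rewrite /v seriesSr.
  apply: (le_trans (lerD IH (le_trans (sP (y n)).1 (ler_wpM2l M0 (yle n))))).
  rewrite exprSr le_eqVlt; apply/orP; left; apply/eqP; field.
  by rewrite expf_neq0.
have nub n : v n <= 2 * M * `|L x|.
  by apply: (le_trans (nle n)); rewrite ler_piMr ?mulr_ge0.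
have cu : cvgn (series u).
  apply: normed_cvg; rewrite -[X in cvgn X]/v; apply: nondecreasing_is_cvgn.
    by apply: nondecreasing_series.
  by exists (2 * M * `|L x|) => _ [n _ <-].
have y0 : y n @[n --> \oo] --> 0.
  apply/norm_cvg0P; apply: (@squeeze_cvgr _ _ _ _ (cst 0) (geometric `|L x| 2^-1)).
  - by apply: nearW => n; rewrite normr_ge0 /geometric/= exprVn yle.
  - exact: cvg_cst.
  - by apply: cvg_geometric; rewrite gtr0_norm// invf_lt1// ltr1n.
have Llim : L (limn (series u)) = L x.
  have c1 : L (series u n) @[n --> \oo] --> L (limn (series u)).
    by apply: (continuous_cvg _ (cL _)).
  have c2 : L (series u n) @[n --> \oo] --> L x.
    under eq_fun do rewrite uy.
    have := cvgB (cvg_cst (L x)) y0; rewrite subr0; apply.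
  exact: cvg_unique c1 c2.
(* The sum of the series is [x] itself, since [L] is injective and maps both to [L x]. *)
have -> : `|x| = `|limn (series u)| by rewrite -[in LHS](LK x) -Llim LK.
apply: (@le_trans _ _ (2 * M * `|L x|)); last by rewrite ler_wpM2r// lerDl.
rewrite -lim_norm//; apply: limr_le; first exact: is_cvg_norm.
by apply: nearW => n; apply: le_trans (nub n); exact: ler_norm_sum.
Qed.

(** * Fixed points of contractions *)

Lemma contraction_fixed_point (R : realType) (X : completeNormedModType R)
    (U : set X) (f : X -> X) (q : R) :
  closed U -> U !=set0 -> (forall x, U x -> U (f x)) -> 0 <= q < 1 ->
  (forall x y, U x -> U y -> `|f x - f y| <= q * `|x - y|) ->
  exists2 p, U p & p = f p.
Proof.
move=> cU U0 fU /andP[q0 q1] fq.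
have fUh : {homo f : x / U x >-> U x} by [].
have ctr : is_contraction (mkfun_fun fUh).
  by exists (NngNum q0); split=> // -[x y] [Ux Uy]; exact: fq.
exact: banach_fixed_point ctr cU U0.
Qed.

(** * Strict differentiability *)

(** Arbitrary pairs of points near [p] are compared through the derivative at [p] alone. This is
    what the contraction argument uses, and it passes to compositions without control of derivatives
    at other points. *)
Definition strictly_differentiable (R : realType) (V W : normedModType R)
    (f : V -> W) (p : V) : Prop :=
  differentiable f p /\ forall e : R, 0 < e -> exists2 d : R, 0 < d &
    forall r s, `|r - p| < d -> `|s - p| < d ->
      `|f r - f s - 'd f p (r - s)| <= e * `|r - s|.

(** On a small ball around [p] all derivatives lie within [e] of the one at [p]; the ball is convex,
    so the mean value inequality applies to every pair in it. *)
Lemma C1_near_strictly_differentiable (R : realType) (V W : normedModType R)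
    (f : V -> W) (p : V) : C1_near f p -> strictly_differentiable f p.
Proof.
move=> C1f; have [dfp df_cont] := nbhs_singleton C1f; split=> // e e0.
have : \forall q \near p, differentiable f q /\
    forall v, `|'d f q v - 'd f p v| <= e * `|v|.
  by apply: filterS2 C1f (df_cont e e0) => q [dfq _] dfqp.
move=> /nbhs_normP[d d0 dP]; exists d => // r s rp sp.
apply: mean_value_linear => [|t /andP[t0 t1]]; first exact: diff_continuous.
apply: dP => /=; rewrite distrC.
have -> : s + t *: (r - s) - p = (1 - t) *: (s - p) + t *: (r - p).
  rewrite scalerBl scale1r addrAC -[RHS]addrA; congr (_ + _).
  by rewrite [RHS]addrC -scalerBr opprB addrA subrK.
apply: (le_lt_trans (ler_normD _ _)); rewrite !normrZ.
rewrite ger0_norm ?subr_ge0// ger0_norm//.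
apply: (@le_lt_trans _ _ (Num.max `|s - p| `|r - p|)); last by rewrite gt_max sp.
have m1 : `|s - p| <= Num.max `|s - p| `|r - p| by rewrite le_max lexx.
have m2 : `|r - p| <= Num.max `|s - p| `|r - p| by rewrite le_max lexx orbT.
have t1' : 0 <= 1 - t by rewrite subr_ge0.
rewrite (le_trans (lerD (ler_wpM2l t1' m1) (ler_wpM2l t0 m2)))//.
by rewrite -mulrDl subrK mul1r.
Qed.

Lemma strictly_differentiable_linear (R : realType) (V W : normedModType R)
    (f : {linear V -> W}) (p : V) : continuous f -> strictly_differentiable f p.
Proof.
move=> cf; split; first exact: linear_differentiable.
move=> e e0; exists 1 => // r s _ _.
by rewrite diff_lin// linearB/= subrr normr0 mulr_ge0// ltW.
Qed.

Lemma strictly_differentiable_pair (R : realType) (V W W' : normedModType R)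
    (f : V -> W) (g : V -> W') (p : V) :
  strictly_differentiable f p -> strictly_differentiable g p ->
  strictly_differentiable (fun x => (f x, g x)) p.
Proof.
move=> [df sf] [dg sg]; split; first exact: differentiable_pair.
move=> e e0; have [d1 d10 fP] := sf e e0; have [d2 d20 gP] := sg e e0.
exists (Num.min d1 d2); first by rewrite lt_min d10.
move=> r s; rewrite !lt_min => /andP[r1 r2] /andP[s1 s2].
rewrite diff_pair// prod_normE ge_max/=; apply/andP; split.
  exact: fP.
exact: gP.
Qed.

(** The error splits into that of [g] on the increment [f r - f s] and the image under ['d g (f p)]
    of the error of [f]. *)
Lemma strictly_differentiable_comp (R : realType) (U V W : normedModType R)
    (f : U -> V) (g : V -> W) (p : U) :
  strictly_differentiable f p -> strictly_differentiable g (f p) ->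
  strictly_differentiable (g \o f) p.
Proof.
move=> [df sf] [dg sg]; split; first exact: differentiable_comp.
move=> e e0.
have [K K0 KP] := linear_lipschitz (diff_continuous df).
have [K' K'0 K'P] := linear_lipschitz (diff_continuous dg).
(* Each error receives half of [e]: [e1] compensates the bound [K'] on the derivative of [g], and
   [e2] the local Lipschitz constant [e1 + K] of [f]. *)
pose e1 := e / (2 * K').
have e10 : 0 < e1 by rewrite divr_gt0 ?mulr_gt0.
have [d1 d10 fP] := sf e1 e10.
have Ke1 : 0 < e1 + K by rewrite addr_gt0.
pose e2 := e / (2 * (e1 + K)).
have e20 : 0 < e2 by rewrite divr_gt0 ?mulr_gt0.
have [d2 d20 gP] := sg e2 e20.
have f_lip r s : `|r - p| < d1 -> `|s - p| < d1 ->
    `|f r - f s| <= (e1 + K) * `|r - s|.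
  move=> rp sp; rewrite -[f r - f s](subrK ('d f p (r - s))).
  by rewrite (le_trans (ler_normD _ _))// mulrDl lerD// fP.
(* The second radius makes [f] send the ball into the ball of radius [d2] around [f p]. *)
exists (Num.min d1 (d2 / (e1 + K))); first by rewrite lt_min d10 divr_gt0.
have f_near r : `|r - p| < Num.min d1 (d2 / (e1 + K)) -> `|f r - f p| < d2.
  rewrite lt_min => /andP[rp]; rewrite ltr_pdivlMr// mulrC.
  by apply: le_lt_trans; apply: f_lip; rewrite // subrr normr0.
move=> r s rp sp.
have [rp1 sp1] : `|r - p| < d1 /\ `|s - p| < d1.
  by move: rp sp; rewrite !lt_min => /andP[? _] /andP[? _].
rewrite diff_comp//=.
rewrite -[X in `|X - _|](subrK ('d g (f p) (f r - f s))) -addrA -linearB.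
rewrite (le_trans (ler_normD _ _))//.
have -> : e * `|r - s| = e2 * ((e1 + K) * `|r - s|) + K' * (e1 * `|r - s|).
  have E1 : K' * e1 = e / 2 by rewrite /e1; field; rewrite gt_eqF.
  have E2 : e2 * (e1 + K) = e / 2 by rewrite /e2; field; rewrite gt_eqF.
  by rewrite (mulrA e2) (mulrA K') E1 E2 -mulrDl -splitr.
apply: lerD.
  apply: (le_trans (gP _ _ (f_near _ rp) (f_near _ sp))).
  by rewrite ler_wpM2l ?(ltW e20)// f_lip.
by apply: (le_trans (K'P _)); rewrite ler_wpM2l ?(ltW K'0)// fP.
Qed.

(** * The implicit function theorem *)

(** For fixed [l], the Newton map [T] with derivative frozen at [(a, b)] is a half contraction,
    whose fixed points are the zeros of [h]. The estimate [below] gives uniqueness and Lipschitz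
    dependence. Through [eps] a caller can keep both balls small. *)
Lemma implicit_function (R : realType) (X Y : completeNormedModType R)
    (L : normedModType R) (h : X * L -> Y) (a : X) (b : L)
    (D : {linear X -> Y}) (eps : R) :
  0 < eps -> strictly_differentiable h (a, b) ->
  (forall x, D x = 'd h (a, b) (x, 0)) -> bijective D -> h (a, b) = 0 ->
  exists (r rho K : R) (xi : L -> X),
    [/\ 0 < r <= eps /\ 0 < rho <= eps,
        forall l, `|l - b| < rho -> `|xi l - a| < r /\ h (xi l, l) = 0,
        forall x l, `|x - a| < r -> `|l - b| < rho -> h (x, l) = 0 -> x = xi l
      & forall l l', `|l - b| < rho -> `|l' - b| < rho ->
          `|xi l - xi l'| <= K * `|l - l'| ].
Proof.
move=> eps0 [dh sh] DE bijD hab.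
have pairE x l x' l' : (x, l) - (x', l') = (x - x', l - l') :> X * L by [].
have norm_pair (x : X) (l : L) : `|(x, l)| = Num.max `|x| `|l| by [].
have cD : continuous D.
  rewrite (_ : (D : X -> Y) = 'd h (a, b) \o (fun x => (x, 0))); last exact/funext.
  move=> x; apply: continuous_comp; last exact: diff_continuous.
  by apply: cvg_pair => //; exact: cvg_cst.
have [C C0 CP] := bijective_linear_bounded_below cD bijD.
have [Dinv DK KD] := bijD.
(* As [C * e = 1 / 2], the deviation of [h] from [D] can be absorbed in [below] and gives the
   contraction factor in [TP]. *)
pose e := (2 * C)^-1; have e0 : 0 < e by rewrite invr_gt0 mulr_gt0.
have [d d0 hP] := sh e e0.
have [M M0 MP] := linear_lipschitz (diff_continuous dh).
have h_lip x l l' : `|x - a| < d -> `|l - b| < d -> `|l' - b| < d ->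
    `|h (x, l) - h (x, l')| <= (e + M) * `|l - l'|.
  move=> xa lb lb'.
  have -> : `|l - l'| = `|(x, l) - (x, l')|.
    by rewrite pairE norm_pair subrr normr0; apply/esym/max_idPr.
  rewrite -[h (x, l) - h (x, l')](subrK ('d h (a, b) ((x, l) - (x, l')))).
  rewrite (le_trans (ler_normD _ _))// mulrDl lerD// hP//.
    by rewrite pairE norm_pair gt_max xa.
  by rewrite pairE norm_pair gt_max xa.
have h_part x x' l : `|x - a| < d -> `|x' - a| < d -> `|l - b| < d ->
    `|h (x, l) - h (x', l) - D (x - x')| <= e * `|x - x'|.
  move=> xa xa' lb; rewrite DE.
  have -> : (x - x', 0) = (x, l) - (x', l) :> X * L by rewrite pairE subrr.
  have -> : `|x - x'| = `|(x, l) - (x', l)|.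
    by rewrite pairE norm_pair subrr normr0; apply/esym/max_idPl.
  by apply: hP; rewrite pairE norm_pair gt_max ?xa ?xa'.
pose r := Num.min (d / 2) eps.
have r0 : 0 < r by rewrite lt_min divr_gt0.
have rd : r < d by rewrite gt_min ltr_pdivrMr// ltr_pMr// ltr1n.
have eM0 : 0 < e + M by rewrite addr_gt0.
(* [K] becomes the Lipschitz constant of [xi]; the choice [rho <= r / K] keeps solutions within [r]
   of [a]. *)
pose K := 2 * C * (e + M); have K0 : 0 < K by rewrite !mulr_gt0.
pose rho := Num.min r (r / K).
have rho0 : 0 < rho by rewrite lt_min r0 divr_gt0.
have rhor : rho <= r by rewrite ge_min lexx.
have rhod : rho < d by exact: le_lt_trans rd.
have below x x' l : `|x - a| < d -> `|x' - a| < d -> `|l - b| < d ->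
    `|x - x'| <= 2 * C * `|h (x, l) - h (x', l)|.
  move=> xa xa' lb.
  have : `|x - x'| <= C * (`|h (x, l) - h (x', l)| + e * `|x - x'|).
    apply: (le_trans (CP _)); rewrite ler_wpM2l ?(ltW C0)//.
    rewrite -[D (x - x')](subKr (h (x, l) - h (x', l))).
    by rewrite (le_trans (ler_normB _ _))// lerD// h_part.
  rewrite mulrDr mulrA (_ : C * e = 2^-1); last first.
    by rewrite /e; field; rewrite gt_eqF.
  lra.
(* The fixed point is found in the closed ball of radius [r]; being a zero of [h], it lies in the
   open one. *)
have bound_a x l : `|x - a| < d -> `|l - b| < rho -> h (x, l) = 0 -> `|x - a| < r.
  move=> xa lb hxl; have lbd : `|l - b| < d by exact: lt_trans rhod.
  have /le_lt_trans : `|x - a| <= K * `|l - b|.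
    apply: (le_trans (@below x a l xa _ lbd)); first by rewrite subrr normr0.
    rewrite hxl -[X in `|X - h _|]hab -[leRHS]mulrA ler_wpM2l ?mulr_ge0 ?(ltW C0)//.
    by rewrite [`|l - b|]distrC h_lip// subrr normr0.
  by apply; rewrite mulrC -ltr_pdivlMr// (lt_le_trans lb)// ge_min lexx orbT.
have solve l : `|l - b| < rho -> exists x, `|x - a| < r /\ h (x, l) = 0.
  move=> lb; have lbd : `|l - b| < d by exact: lt_trans rhod.
  pose T x := x - Dinv (h (x, l)).
  have DinvB y y' : Dinv y - Dinv y' = Dinv (y - y').
    by apply: (can_inj DK); rewrite linearB !KD.
  pose U := [set x : X | `|x - a| <= r].
  have Ud x : U x -> `|x - a| < d by move=> /le_lt_trans; apply.
  have TP x x' : U x -> U x' -> `|T x - T x'| <= 2^-1 * `|x - x'|.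
    move=> /Ud xa /Ud xa'.
    have -> : T x - T x' = (x - x') - Dinv (h (x, l) - h (x', l)).
      by rewrite -DinvB /T subrACA.
    apply: (le_trans (CP _)); rewrite linearB KD distrC.
    apply: (le_trans (ler_wpM2l (ltW C0) (h_part _ _ _ xa xa' lbd))).
    by rewrite mulrA (_ : C * e = 2^-1)// /e; field; rewrite gt_eqF.
  have Ua : U a by rewrite /U/= subrr normr0 ltW.
  (* Since the centre moves by at most [r / 2], the half contraction [T] maps the closed ball into
     itself. *)
  have Ta : `|T a - a| <= r / 2.
    rewrite /T addrAC subrr add0r normrN (le_trans (CP _))// KD.
    rewrite -[h _]subr0 -hab.
    apply: (@le_trans _ _ (C * ((e + M) * rho))).
      rewrite ler_wpM2l ?(ltW C0)//.
      apply: (le_trans (h_lip _ _ _ _ lbd _)); rewrite ?subrr ?normr0//.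
      by rewrite ler_wpM2l ?(ltW eM0)// ltW.
    have : rho * K <= r by rewrite -ler_pdivlMr// ge_min lexx orbT.
    rewrite /K; nra.
  have [||||x Ux xT] := @contraction_fixed_point _ X U T 2^-1 _ _ _ _ TP.
  - rewrite (_ : U = closed_ball a r) ?closed_ballE//; last first.
      by apply/seteqP; split=> x; rewrite /U /closed_ball_/= distrC.
    by rewrite -closed_ballE//; exact: closed_ball_closed.
  - by exists a.
  - move=> x Ux; rewrite /U/= -(subrK (T a) (T x)) -addrA.
    rewrite (le_trans (ler_normD _ _))// (splitr r) lerD//.
    by rewrite (le_trans (TP _ _ Ux Ua))// mulrC ler_wpM2r.
  - by rewrite invr_ge0 ler0n invf_lt1 ?ltr1n.
  have hx : h (x, l) = 0.
    suff : Dinv (h (x, l)) = 0 by move=> h0; rewrite -[LHS]KD h0 linear0.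
    by apply: oppr_inj; apply: (addrI x); rewrite oppr0 addr0; exact/esym.
  by exists x; split=> //; apply: bound_a hx => //; exact: Ud.
have /choice[xi xiP] : forall l, exists x, `|l - b| < rho ->
    `|x - a| < r /\ h (x, l) = 0.
  move=> l; have [/solve[x xP]|lb] := ltP `|l - b| rho; first by exists x.
  (* A default value outside the ball, where the implication is vacuous. *)
  by exists 0.
exists r, rho, K, xi; split=> //.
- by rewrite r0 rho0 (le_trans rhor)// ge_min lexx orbT.
- move=> x l xa lb hxl; have [xia hxi] := xiP l lb.
  apply/eqP; rewrite -subr_eq0 -normr_le0.
  rewrite (le_trans (@below x (xi l) l _ _ _))//.
  + exact: lt_trans rd.
  + exact: lt_trans rd.
  + exact: lt_trans rhod.
  by rewrite hxl hxi subrr normr0 mulr0.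
- move=> l l' lb lb'; have [xia hxi] := xiP l lb; have [xia' hxi'] := xiP l' lb'.
  rewrite (le_trans (@below (xi l) (xi l') l _ _ _))//.
  + exact: lt_trans rd.
  + exact: lt_trans rd.
  + exact: lt_trans rhod.
  rewrite hxi -[X in `|X - h _|]hxi' -[leRHS]mulrA ler_wpM2l ?mulr_ge0 ?(ltW C0)//.
  rewrite [`|l - l'|]distrC.
  by apply: h_lip; [exact: lt_trans rd|exact: lt_trans rhod|exact: lt_trans rhod].
Qed.

(** * Perturbations of the identity and boundaries of images *)

(* The library declares both structures on matrices, but not their join. *)
HB.instance Definition _ (R : realType) m n := Complete.on 'M[R]_(m, n).

(** Solving [x + f x = y] is a fixed point problem for [x |-> y - f x]; the lower bound on
    increments of [phi] makes it injective with a Lipschitz inverse. *)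
Lemma contractive_perturbation_homeo (R : realType) (X : completeNormedModType R)
    (f : X -> X) :
  (forall x y, `|f x - f y| <= 2^-1 * `|x - y|) ->
  exists psi : X -> X, [/\ cancel (fun x => x + f x) psi,
    cancel psi (fun x => x + f x) & forall x y, `|psi x - psi y| <= 2 * `|x - y|].
Proof.
move=> f_lip; pose phi x := x + f x.
have below x y : `|x - y| <= 2 * `|phi x - phi y|.
  have : `|x - y| <= `|phi x - phi y| + 2^-1 * `|x - y|.
    have -> : x - y = phi x - phi y - (f x - f y) by rewrite /phi subrACA !addrK.
    rewrite (le_trans (ler_normB _ _))// lerD//.
    by rewrite (le_trans (f_lip _ _))// /phi subrACA !addrK.
  lra.
have surj y : exists x, phi x = y.
  have [|||||x _ xE] := @contraction_fixed_point R X setT (fun x => y - f x) 2^-1.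
  - exact: closedT.
  - by exists 0.
  - by [].
  - by rewrite invr_ge0 ler0n invf_lt1 ?ltr1n.
  - move=> x x' _ _; rewrite opprB addrC addrA subrK distrC.
    exact: f_lip.
  by exists x; rewrite /phi {1}xE subrK.
have [psi psiK] := choice surj.
exists psi; split=> [x|//|x y].
  apply/eqP; rewrite -subr_eq0 -normr_le0.
  by rewrite (le_trans (below _ _))// psiK subrr normr0 mulr0.
by rewrite (le_trans (below _ _))// !psiK.
Qed.

(** Neighborhoods correspond under [phi], which settles interiors directly and closures through
    complements. *)
Lemma bdry_image_homeo (S T : topologicalType) (phi : S -> T) (psi : T -> S)
    (A : set S) :
  cancel phi psi -> cancel psi phi -> continuous phi -> continuous psi ->
  bdry (phi @` A) = phi @` bdry A.
Proof.
move=> phiK psiK cphi cpsi.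
have nbhsE (B : set S) x : nbhs (phi x) (phi @` B) <-> nbhs x B.
  split=> [/cphi nB|nB]; last first.
    have npB : nbhs (phi x) (psi @^-1` B) by apply: cpsi; rewrite phiK.
    by apply: filterS npB => y By; exists (psi y).
  have npB : nbhs x (phi @^-1` (phi @` B)) by exact: nB.
  by apply: filterS npB => y [z Bz /(can_inj phiK) zy]; rewrite -zy.
have clE x : closure (phi @` A) (phi x) <-> closure A x.
  have E (T' : topologicalType) (B : set T') y : closure B y <-> ~ nbhs y (~` B).
    have -> : nbhs y (~` B) = interior (~` B) y by [].
    by rewrite interiorC; split=> [cB /(_ cB)|/contrapT].
  rewrite !E -nbhsE (_ : ~` (phi @` A) = phi @` (~` A))//.
  apply/seteqP; split=> [y Ay|_ [x' Ax' <-] [z Az /(can_inj phiK) zx']].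
    by exists (psi y); rewrite ?psiK// => Apsiy; apply: Ay; exists (psi y).
  by apply: Ax'; rewrite -zx'.
apply/seteqP; split=> [y|_ [x [clx intx] <-]].
  rewrite -(psiK y) => -[/clE cly inty]; exists (psi y) => //; split=> //.
  by move=> /nbhsE.
by split; [exact/clE|move=> /nbhsE].
Qed.

(** * Comparison of the Euclidean and sup norms *)

Section euclidean_norm.
Variables (R : realType) (N : nat).
Implicit Types u : 'rV[R]_N.

Lemma norm_coord_le u i : `|u 0 i| <= `|u|.
Proof.
rewrite [leRHS]/Num.norm /= mx_normrE; apply/bigmax_geP; right => /=.
by exists (0, i).
Qed.

Lemma norm_coord_le_enorm u i : `|u 0 i| <= enorm u.
Proof.
rewrite -sqrtr_sqr ler_wsqrtr// expr2 /dotv (bigD1 i)//= lerDl sumr_ge0// => j _.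
by rewrite -expr2 sqr_ge0.
Qed.

Lemma norm_le_enorm u : `|u| <= enorm u.
Proof.
rewrite [leLHS]/Num.norm /= mx_normrE; apply/bigmax_leP; split=> [|[i j] _ /=].
  exact: sqrtr_ge0.
by rewrite (ord1 i) norm_coord_le_enorm.
Qed.

Lemma enorm_le_norm u : enorm u <= N%:R * `|u|.
Proof.
have Nu : 0 <= N%:R * `|u| by rewrite mulr_ge0.
rewrite -[leRHS]ger0_norm// -sqrtr_sqr ler_wsqrtr//.
apply: (@le_trans _ _ (\sum_(i < N) `|u| ^+ 2)).
  apply: ler_sum => i _; rewrite -expr2 -real_normK ?num_real//.
  by rewrite lerXn2r ?nnegrE// norm_coord_le.
rewrite sumr_const card_ord exprMn -[leLHS]mulr_natl ler_wpM2r ?sqr_ge0//.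
by rewrite -natrX ler_nat; case: (N) => // n; rewrite expnS leq_pmulr// expn_gt0.
Qed.

End euclidean_norm.

(** * Hausdorff measures and surface null sets under Lipschitz maps *)

Section hausdorff_lipschitz.
Local Open Scope ereal_scope.
Variables (R : realType) (N : nat) (phi : 'rV[R]_N -> 'rV[R]_N) (K : R).
Hypotheses (K0 : (0 < K)%R)
  (phi_lip : forall x y, (enorm (phi x - phi y) <= K * enorm (x - y))%R).

Lemma diam_lipschitz A : diam (phi @` A) <= K%:E * diam A.
Proof.
apply: ge_ereal_sup => _ [_ [x Ax <-] [_ [y Ay <-] <-]].
apply: (@le_trans _ _ (K%:E * (enorm (x - y))%:E)).
  by rewrite -EFinM lee_fin.
rewrite lee_wpmul2l ?lee_fin ?(ltW K0)//; apply: ereal_sup_ubound.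
by exists x => //; exists y.
Qed.

Lemma diam_ge0 (A : set 'rV[R]_N) : A !=set0 -> 0 <= diam A.
Proof.
move=> [x Ax]; apply: (@le_trans _ _ (enorm (x - x))%:E).
  by rewrite lee_fin sqrtr_ge0.
by apply: ereal_sup_ubound; exists x => //; exists x.
Qed.

(** A set of diameter at most [delta / K] has an image of diameter at most [delta]; for a larger set
    the right-hand side is infinite. *)
Lemma hausdorff_gauge_lipschitz k delta A :
  hausdorff_gauge k delta (phi @` A) <=
  (K ^+ k)%:E * hausdorff_gauge k (delta / K) A.
Proof.
have Kk : (0 < K ^+ k)%R by rewrite exprn_gt0.
rewrite {2}/hausdorff_gauge; case: ifPn => [/eqP->|/set0P A0].
  by rewrite image_set0 hausdorff_gauge0 mule0.
case: ifPn => [dA|_]; last by rewrite gt0_muley ?leey.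
have dA0 := diam_ge0 A0.
have dAfin : diam A \is a fin_num.
  by rewrite ge0_fin_numE// (le_lt_trans dA)// ltry.
have pA0 : phi @` A !=set0 by case: A0 => x Ax; exists (phi x); exists x.
have dpA := diam_lipschitz A.
have dpA0 := diam_ge0 pA0.
rewrite /hausdorff_gauge; case: ifPn => [/eqP pA|_]; first by case: pA0; rewrite pA.
have dpAd : diam (phi @` A) <= delta%:E.
  rewrite (le_trans dpA)// -(fineK dAfin) muleC -EFinM lee_fin.
  by rewrite -ler_pdivlMr// -lee_fin fineK.
rewrite dpAd -EFinM lee_fin mulrCA ler_wpM2l ?ball_volume_ge0// -exprMn.
have f0 : (0 <= fine (diam (phi @` A)) / 2)%R by rewrite divr_ge0// fine_ge0.
rewrite lerXn2r ?nnegrE ?mulr_ge0 ?divr_ge0 ?fine_ge0// ?(ltW K0)//.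
rewrite mulrA ler_wpM2r//.
have dpAfin : diam (phi @` A) \is a fin_num.
  by rewrite ge0_fin_numE// (le_lt_trans dpAd)// ltry.
by rewrite -lee_fin EFinM (fineK dpAfin) (fineK dAfin).
Qed.

(** A cover of [A] is pushed forward to a cover of the image, with scale [delta / K] upstairs and
    [delta] downstairs. *)
Lemma hausdorff_lipschitz k A :
  hausdorff k (phi @` A) <= (K ^+ k)%:E * hausdorff k A.
Proof.
have Kk : (0 < K ^+ k)%R by rewrite exprn_gt0.
apply: ge_ereal_sup => _ [delta /= delta0 <-].
apply: (@le_trans _ _ ((K ^+ k)%:E * hausdorff_pre k (delta / K) A)); last first.
  by rewrite lee_wpmul2l ?lee_fin ?(ltW Kk)// hausdorff_pre_le// divr_gt0.
rewrite -lee_pdivrMl//.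
apply: le_ereal_inf_tmp => _ [F [_ AF] <-].
rewrite lee_pdivrMl// -nneseriesZl; last by move=> i _; exact: hausdorff_gauge_ge0.
apply: (@le_trans _ _ (\sum_(i <oo) hausdorff_gauge k delta (phi @` F i))).
  apply: ereal_inf_lbound; exists (fun i => phi @` F i) => //; split=> // _ [x Ax <-].
  by have [i _ Fx] := AF x Ax; exists i => //; exists x.
apply: lee_nneseries => [i _ _|i _]; first exact: hausdorff_gauge_ge0.
exact: hausdorff_gauge_lipschitz.
Qed.

End hausdorff_lipschitz.

(** Sets of zero outer measure are Caratheodory measurable, so the exceptional set can serve as its
    own measurable null cover. *)
Lemma surf_aeP (R : realType) (N : nat) (A : set 'rV[R]_N)
    (P : 'rV[R]_N -> Prop) :
  surf_ae A P <-> hausdorff N.-1 (A `&` ~` [set x | P x]) = 0%E.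
Proof.
have E : ~` [set x | A x -> P x] = A `&` ~` [set x | P x].
  by apply/seteqP; split=> x /=; [move=> /not_implyP|move=> [Ax nP] /(_ Ax)].
rewrite -E; split=> [[B [mB B0 AB]]|H0].
  apply/eqP; rewrite eq_le hausdorff_ge0 andbT -B0.
  exact: le_hausdorff.
exists (~` [set x | A x -> P x]); split=> //.
apply: (@le_caratheodory_measurable _ _ (hausdorff_outer R N N.-1)) => X.
have -> : hausdorff_outer R N N.-1 (X `&` ~` [set x | A x -> P x]) = 0%E.
  apply/eqP; rewrite eq_le outer_measure_ge0 andbT -H0.
  by apply: le_outer_measure; exact: subIsetr.
by rewrite add0e; apply: le_outer_measure; exact: subIsetl.
Qed.

(** The exceptional sets on the two sides are exchanged by [phi] and [psi], and Lipschitz maps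
    preserve null sets. *)
Lemma surf_ae_image (R : realType) (N : nat) (phi psi : 'rV[R]_N -> 'rV[R]_N)
    (K : R) (A : set 'rV[R]_N) (P : 'rV[R]_N -> Prop) :
  0 < K -> cancel phi psi ->
  (forall x y, enorm (phi x - phi y) <= K * enorm (x - y)) ->
  (forall x y, enorm (psi x - psi y) <= K * enorm (x - y)) ->
  surf_ae (phi @` A) P <-> surf_ae A (P \o phi).
Proof.
move=> K0 phiK phi_lip psi_lip; rewrite !surf_aeP.
have E1 : phi @` A `&` ~` [set x | P x] =
    phi @` (A `&` ~` [set x | (P \o phi) x]).
  apply/seteqP; split=> [_ [[x Ax <-] nP]|_ [x [Ax nP] <-]].
    by exists x.
  by split=> //; exists x.
have E2 : A `&` ~` [set x | (P \o phi) x] =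
    psi @` (phi @` A `&` ~` [set x | P x]).
  rewrite E1 image_comp (_ : psi \o phi = id) ?image_id//.
  by apply/funext => x; exact: phiK.
split=> H0; apply/eqP; rewrite eq_le hausdorff_ge0 andbT.
  by rewrite E2 (le_trans (hausdorff_lipschitz K0 psi_lip _ _))// H0 mule0.
by rewrite E1 (le_trans (hausdorff_lipschitz K0 phi_lip _ _))// H0 mule0.
Qed.

(** * Lipschitz bounds for compactly supported C^1 fields *)

Section C0k_lipschitz.
Context {R : realType} {N : nat}.
Implicit Types (U : set 'rV[R]_N) (f : 'rV[R]_N -> 'rV[R]_N).

Lemma continuous_compact_support_bounded (K : set 'rV[R]_N) f :
  compact K -> continuous f -> (forall x, ~ K x -> f x = 0) ->
  exists2 M : R, 0 <= M & forall x, `|f x| <= M.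
Proof.
move=> cK cf f0.
have /compact_bounded/pinfty_ex_gt0[M M0 MP] : compact (f @` K).
  by apply: continuous_compact => //; exact: continuous_subspaceT.
exists M; first exact: ltW.
move=> x; have [Kx|/f0 ->] := pselect (K x); last by rewrite normr0 ltW.
by apply: MP; exists x.
Qed.

(* [C1_norm] is a supremum of reals, which is junk on unbounded sets: the compact
   support of [f] makes the set bounded. *)
Lemma enorm_derive_le_C1_norm U f x v :
  bounded_set U -> C0k 1 U f -> enorm v <= 1 -> enorm ('D_v f x) <= C1_norm f.
Proof.
move=> bU [[df cDf] f0] v1.
have cf y : {for y, continuous f} by exact: differentiable_continuous.
have ccU : compact (closure U).
  apply: bounded_closed_compact; last exact: closed_closure.
  have [M M0 UM] := pinfty_ex_gt0 bU; exists M; split; first exact: num_real.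
  move=> M' MM' x' clUx'; apply: le_trans (ltW MM').
  suff : closed_ball 0 M x' by rewrite closed_ballE// /closed_ball_/= sub0r normrN.
  have -> : closed_ball (0 : 'rV[R]_N) M = closure (closed_ball 0 M).
    exact/closure_id/closed_ball_closed.
  apply: closureS clUx' => y Uy.
  by rewrite closed_ballE// /closed_ball_/= sub0r normrN; exact: UM.
have Df0 w y : ~ closure U y -> 'D_w f y = 0.
  move=> Uy; have [->|w0] := eqVneq w 0; first exact: derive0.
  rewrite -(derive_cst (0 : 'rV[R]_N) y w); apply: near_eq_derive => //.
  have : nbhs y (~` closure U)
    by apply: open_nbhs_nbhs; split=> //; exact/closed_openC/closed_closure.
  by apply: filterS => z /f0.
have [M M0 fM] := continuous_compact_support_bounded ccU cf f0.
have /choice[M' M'P] : forall i : 'I_N, exists M' : R,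
    forall y, `|'D_(delta_mx 0 i) f y| <= M'.
  move=> i; have [M' _ ?] := continuous_compact_support_bounded ccU
    (cDf (delta_mx 0 i)) (Df0 (delta_mx 0 i)).
  by exists M'.
apply: ub_le_sup; last by exists x; right; exists v.
(* The first summand bounds the values of [f], the second its derivatives, as the coordinates of [w]
   are at most 1 in absolute value. *)
exists (N%:R * M + N%:R * \sum_i M' i) => _ [y [->|[w w1 ->]]].
  rewrite (le_trans (enorm_le_norm _))// ler_wpDr ?ler_wpM2l//.
  by rewrite mulr_ge0// sumr_ge0// => i _; exact: le_trans (M'P i y).
rewrite (le_trans (enorm_le_norm _))// ler_wpDl ?mulr_ge0// ler_wpM2l//.
rewrite deriveE// [w]row_sum_delta linear_sum (le_trans (ler_norm_sum _ _ _))//.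
apply: ler_sum => i _; rewrite linearZ/= normrZ -deriveE//.
rewrite -[leRHS]mul1r ler_pM//.
exact: le_trans (norm_coord_le_enorm _ _) w1.
Qed.

Lemma C0k_lipschitz U f x y :
  bounded_set U -> C0k 1 U f ->
  `|f x - f y| <= N%:R * C1_norm f * `|x - y|.
Proof.
move=> bU C0f; have [[df _] _] := C0f.
apply: mean_value_segment => t _; split=> //; rewrite -deriveE//.
set z := y + _; set v := x - y.
have [->|v0] := eqVneq v 0; first by rewrite derive0 !normr0 mulr0.
have Nv0 : 0 < N%:R * `|v|.
  apply: lt_le_trans (enorm_le_norm v); apply: lt_le_trans (norm_le_enorm v).
  by rewrite normr_gt0.
(* Dividing by [N] times the sup norm brings [v] into the Euclidean unit ball over which [C1_norm]
   is taken. *)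
have : enorm ((N%:R * `|v|)^-1 *: v) <= 1.
  rewrite (le_trans (enorm_le_norm _))// normrZ gtr0_norm ?invr_gt0//.
  by rewrite mulrCA mulVf ?gt_eqF.
move=> /(enorm_derive_le_C1_norm z bU C0f).
move=> /(le_trans (norm_le_enorm _)); rewrite !deriveE// linearZ/= normrZ.
by rewrite gtr0_norm ?invr_gt0// ler_pdivrMl// mulrAC.
Qed.

End C0k_lipschitz.

(** * Null representatives and pullback of the boundary condition *)

Lemma surf_aeS2 (R : realType) (N : nat) (A : set 'rV[R]_N)
    (P1 P2 P : 'rV[R]_N -> Prop) :
  (forall x, P1 x -> P2 x -> P x) -> surf_ae A P1 -> surf_ae A P2 -> surf_ae A P.
Proof.
have FF := ae_filter_ringOfSetsType (@hmeasure R N N.-1).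
move=> P12; apply: (@filterS2 _ _ FF) => x P1x P2x Ax.
by apply: P12; [exact: P1x|exact: P2x].
Qed.

Lemma l2_repr_eq0 (R : realType) (N m : nat) (A : set 'rV[R]_N)
    (Y : banach_L2_space m A) (f : Y) :
  surf_ae A (fun x => l2_repr f x = 0) <-> f = 0.
Proof.
have repr0 : surf_ae A (fun x => l2_repr (0 : Y) x = 0).
  (* [l2_repr] is linear only almost everywhere; writing 0 as [-1 *: 0 + 0] shows that its
     representative vanishes almost everywhere. *)
  have := l2_reprP (-1) (0 : Y) 0; rewrite scaler0 addr0 => H.
  by apply: (surf_aeS2 _ H H) => x ->; rewrite scaleN1r addNr.
split=> [f0|->//]; apply: l2_repr_inj.
by apply: surf_aeS2 f0 repr0 => x -> ->.
Qed.

Lemma fs_eval0 (R : realType) (N : nat) (A : set 'rV[R]_N) (V : lmodType R)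
    (F : banach_fun_space A V) x : fs_eval (0 : F) x = 0.
Proof.
by have := fs_evalP (-1) (0 : F) 0 x; rewrite scaler0 addr0 scaleN1r addNr.
Qed.

Lemma lipschitz_in_continuous (R : realType) (V W : normedModType R) (A : set V)
    (f : V -> W) (K : R) : open A ->
  (forall x y, A x -> A y -> `|f x - f y| <= K * `|x - y|) ->
  {in A, continuous f}.
Proof.
move=> oA f_lip x; rewrite inE => Ax; apply/cvgrPdist_lt => e e0.
(* [K] may have any sign, hence this positive majorant. *)
have K1 : 0 < `|K| + 1 by rewrite ltr_wpDl.
have nA : \forall y \near x, A y by exact: open_nbhs_nbhs.
have : \forall y \near x, `|x - y| < e / (`|K| + 1).
  by apply/nbhs_normP; exists (e / (`|K| + 1)) => //=; rewrite divr_gt0.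
apply: filterS2 nA => y Ay; rewrite ltr_pdivlMr// mulrC; apply: le_lt_trans.
apply: (le_trans (f_lip _ _ Ax Ay)); rewrite ler_wpM2r// (le_trans (ler_norm _))//.
by rewrite lerDl.
Qed.

(** The factor 1/2 makes [Id + theta] a bi-Lipschitz homeomorphism, so the condition can be pulled
    back to the fixed boundary of [D]. *)
Lemma vanishes_on_bdry_deform (R : realType) (N m : nat) (D : set 'rV[R]_N)
    (theta : 'rV[R]_N -> 'rV[R]_N) (u : 'rV[R]_N -> 'rV[R]_m) :
  (forall x y, `|theta x - theta y| <= 2^-1 * `|x - y|) ->
  vanishes_on_bdry (deform theta D) u <->
  surf_ae (bdry D) (fun x => u (x + theta x) = 0).
Proof.
move=> theta_lip; pose phi x := x + theta x.
have [psi [phiK psiK psi_lip]] := contractive_perturbation_homeo theta_lip.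
have phi_lip x y : `|phi x - phi y| <= 2 * `|x - y|.
  have -> : phi x - phi y = x - y + (theta x - theta y).
    by rewrite /phi opprD addrACA.
  rewrite (le_trans (ler_normD _ _))// mulr_natl mulr2n lerD2l.
  by rewrite (le_trans (theta_lip _ _))// ler_piMl// invf_le1// ler1n.
have lip_cont (s : 'rV[R]_N -> 'rV[R]_N) :
    (forall x y, `|s x - s y| <= 2 * `|x - y|) -> continuous s.
  move=> s_lip x; apply: (@lipschitz_in_continuous _ _ _ setT s 2) => //.
    exact: openT.
  by rewrite inE.
(* Passing between the norms costs a factor [N]; the added 1 keeps the constant positive even when
   [N = 0]. *)
have lip_enorm (s : 'rV[R]_N -> 'rV[R]_N) :
    (forall x y, `|s x - s y| <= 2 * `|x - y|) ->
    forall x y, enorm (s x - s y) <= (N%:R * 2 + 1) * enorm (x - y).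
  move=> s_lip x y; rewrite (le_trans (enorm_le_norm _))//.
  apply: (@le_trans _ _ (N%:R * 2 * enorm (x - y))).
    rewrite -mulrA ler_wpM2l// (le_trans (s_lip _ _))// ler_wpM2l//.
    exact: norm_le_enorm.
  by rewrite ler_wpM2r ?sqrtr_ge0// lerDl.
rewrite /vanishes_on_bdry -[deform _ _]/(phi @` D).
rewrite (bdry_image_homeo D phiK psiK); [|exact: lip_cont|exact: lip_cont].
apply: (surf_ae_image (K := N%:R * 2 + 1)) phiK _ _ => //.
- exact: lip_enorm.
- exact: lip_enorm.
Qed.

(** * Continuation of nondegenerate critical shapes *)

Theorem theoremI (R : realType) (N m : nat) (hN : (2 <= N)%N)
  (* the reference set and the neighborhood of its boundary *)
  (Omega U : set 'rV[R]_N)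
  (hOmega : C1_domain Omega) (hOmega_cpt : compact (bdry Omega))
  (hU : C1_domain U) (hU_bd : bounded_set U) (hU_nbhs : bdry Omega `<=` U)
  (* deformations, parameters, and the family g *)
  (Theta Theta_reg : banach_fun_space (closure U) 'rV[R]_N)
  (hTheta : deformation_spaces Theta Theta_reg)
  (Lam : completeNormedModType R)
  (g : set 'rV[R]_N -> Lam -> 'rV[R]_N -> 'rV[R]_m)
  (hg : forall omega, admissible Theta Omega omega ->
          forall lam, L2_on (bdry omega) (g omega lam))
  (* variational structure *)
  (J : set 'rV[R]_N -> Lam -> 'rV[R]_m)
  (hJ : variational_assumption Theta Omega g J)
  (* extension operator *)
  (X : banach_fun_space (bdry Omega) (R^o))
  (E : X * Lam -> Theta_reg) (hE : extension_operator E)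
  (* regularity *)
  (Y : banach_L2_space m (bdry Omega))
  (Theta_reg' : set Theta_reg) (Lam' : set Lam) (G : Theta_reg * Lam -> Y)
  (hG : regularity_assumption Theta g Theta_reg' Lam' G)
  (* h(xi, lam) = g_{Omega_{xi,lam}}(lam) o (Id + E(xi, lam)), and Q = d_x h(0,0) *)
  (h : X * Lam -> Y) (hh : h = fun p => G (E p, p.2))
  (Q : X -> Y) (hQ : Q = 'd (fun xi : X => h (xi, 0)) (0 : X))
  (* nondegenerate critical shape *)
  (hcrit : vanishes_on_bdry Omega (g Omega 0))
  (hnondeg : bijective Q) :
  let Omega_ xi lam := deform (fs_eval (E (xi, lam))) Omega in
  exists (X'' : set X) (Lam'' : set Lam) (xi : Lam -> X),
    [/\ open_nbhs (0 : X) X'' /\ open_nbhs (0 : Lam) Lam'',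
        {within Lam'', continuous xi} /\ (forall lam, Lam'' lam -> X'' (xi lam)),
        (forall x lam, X'' x -> Lam'' lam ->
           admissible Theta Omega (Omega_ x lam)),
        (forall lam, Lam'' lam ->
           vanishes_on_bdry (Omega_ (xi lam) lam) (g (Omega_ (xi lam) lam) lam))
      & (forall x lam, X'' x -> Lam'' lam ->
           (vanishes_on_bdry (Omega_ x lam) (g (Omega_ x lam) lam) <->
            x = xi lam))].
Proof.
move=> Omega_.
have [[dE C1E] linE _ _] := hE.
have [oT' oL' hGrepr C1G] := hG.
have [_ [hC0k [C1c C1cP]] _ _] := hTheta.
have E0 : E (0, 0) = 0.
  have := linE (-1) 0 0; rewrite scaler0 addr0 => ->.
  by rewrite scaleN1r addNr.
have [eta eta0 eta_lip] : exists2 eta : R, 0 < eta & forall t : Theta_reg,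
    `|t| < eta -> forall x y,
    `|fs_eval t x - fs_eval t y| <= 2^-1 * `|x - y|.
  (* The factor 2 produces the Lipschitz constant 1/2, [N] comes from [C0k_lipschitz], and the last
     factor is a positive majorant of the embedding constant. *)
  pose c := 2 * N%:R * (`|C1c| + 1).
  have c0 : 0 < c by rewrite !mulr_gt0 ?ltr_wpDl// ltr0n (ltn_trans _ hN).
  exists c^-1; first by rewrite invr_gt0.
  move=> t tc x y; apply: (le_trans (C0k_lipschitz x y hU_bd (hC0k t))).
  rewrite ler_wpM2r//.
  have H1 : C1_norm (fs_eval t) <= (`|C1c| + 1) * `|t|.
    apply: (le_trans (C1cP t)); rewrite ler_wpM2r// (le_trans (ler_norm _))//.
    by rewrite lerDl.
  have H2 : c * `|t| <= 1 by rewrite -ler_pdivlMl// mulr1 ltW.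
  rewrite -(ler_pM2l (ltr0n R 2)) mulrA mulfV ?pnatr_eq0//.
  apply: le_trans H2; rewrite /c -!mulrA.
  by rewrite ler_wpM2l// ler_wpM2l.
have vanishE (t : Theta_reg) (lam : Lam) : Theta_reg' t -> Lam' lam ->
    `|t| < eta ->
    vanishes_on_bdry (deform (fs_eval t) Omega) (g (deform (fs_eval t) Omega) lam)
    <-> G (t, lam) = 0.
  move=> tT lL teta; rewrite vanishes_on_bdry_deform; last exact: eta_lip.
  have [_ Gt] := hGrepr t lam tT lL.
  rewrite -l2_repr_eq0; split=> H; apply: surf_aeS2 H Gt => x Hx Gx.
    by rewrite Gx.
  by rewrite -Gx.
have T'0 : Theta_reg' 0 by case: oT'.
have L'0 : Lam' 0 by case: oL'.
have h00 : h (0, 0) = 0.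
  rewrite hh E0; apply/(vanishE 0 0 T'0 L'0); first by rewrite normr0.
  have -> : deform (fs_eval (0 : Theta_reg)) Omega = Omega; last exact: hcrit.
  apply/seteqP; split=> [_ [x Ox <-]|x Ox]; first by rewrite fs_eval0 addr0.
  by exists x => //; rewrite fs_eval0 addr0.
have sh : strictly_differentiable h (0, 0).
  rewrite hh -[fun p => _]/(G \o (fun p => (E p, p.2))).
  apply: strictly_differentiable_comp; last first.
    by rewrite /= E0; exact: C1_near_strictly_differentiable.
  apply: strictly_differentiable_pair.
    exact: C1_near_strictly_differentiable.
  by apply: strictly_differentiable_linear => p; exact: cvg_snd.
(* By the chain rule, the derivative of the restriction to [lam = 0] is the partial derivative that
   [implicit_function] expects. *)
have QE x : 'd (fun xi : X => h (xi, 0)) (0 : X) x = 'd h (0, 0) (x, 0).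
  have di : differentiable (fun xi : X => (xi, 0 : Lam)) (0 : X).
    exact: differentiable_pair.
  rewrite -[fun xi : X => _]/(h \o (fun xi : X => (xi, 0))) diff_comp//=; last first.
    by case: sh.
  by rewrite diff_pair// diff_val diff_cst.
have bij : bijective ('d (fun xi : X => h (xi, 0)) (0 : X)) by rewrite -hQ.
(* Within this radius the deformations fall under the regularity assumption and are 1/2-Lipschitz;
   it is passed to [implicit_function] to bound its balls. *)
have [eps eps0 epsP] : exists2 eps : R, 0 < eps & forall x lam,
    `|x| < eps -> `|lam| < eps ->
    [/\ Theta_reg' (E (x, lam)), Lam' lam & `|E (x, lam)| < eta].
  have cE : {for (0, 0), continuous E} by exact: differentiable_continuous.
  have nT : \forall p \near (0 : X * Lam), Theta_reg' (E p).
    apply: (cE Theta_reg'); rewrite E0; exact: open_nbhs_nbhs.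
  have nE : \forall p \near (0 : X * Lam), `|E p| < eta.
    apply: (cE [set t | `|t| < eta]); rewrite E0; apply/nbhs_norm0P.
    by exists eta.
  have nL : \forall p \near (0 : X * Lam), Lam' p.2.
    apply: (@cvg_snd _ _ (nbhs (0 : X)) (nbhs (0 : Lam)) _ Lam').
    exact: open_nbhs_nbhs.
  have : \forall p \near (0 : X * Lam),
      [/\ Theta_reg' (E p), Lam' p.2 & `|E p| < eta].
    by apply: filterS3 nT nL nE.
  move=> /nbhs_norm0P[eps eps0 epsP]; exists eps => // x lam xeps lameps.
  by apply: (epsP (x, lam)); rewrite /= prod_normE gt_max xeps.
have [r [rho [K [xi [[/andP[r0 reps] /andP[rho0 rhoeps]] xiP uniq lip]]]]] :=
  implicit_function eps0 sh QE bij h00.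
have main x lam : `|x| < r -> `|lam| < rho ->
    [/\ Theta_reg' (E (x, lam)), Lam' lam & `|E (x, lam)| < eta].
  by move=> xr lrho; apply: epsP; [exact: lt_le_trans reps|exact: lt_le_trans rhoeps].
have vanish_h x lam : `|x| < r -> `|lam| < rho ->
    vanishes_on_bdry (Omega_ x lam) (g (Omega_ x lam) lam) <-> h (x, lam) = 0.
  by move=> xr lrho; have [? ? ?] := main x lam xr lrho; rewrite hh; exact: vanishE.
have ballE (V : normedModType R) (e : R) : ball (0 : V) e = [set x | `|x| < e].
  by rewrite -ball_normE; apply/seteqP; split=> x /=; rewrite sub0r normrN.
exists [set x | `|x| < r], [set lam | `|lam| < rho], xi; split.
- split; rewrite -ballE; split; try exact: ballxx; exact: ball_open.
- split; last by move=> lam lrho; have := xiP lam; rewrite !subr0 => /(_ lrho)[].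
  rewrite continuous_open_subspace; last by rewrite -ballE; exact: ball_open.
  apply: (@lipschitz_in_continuous _ _ _ _ xi K).
    by rewrite -ballE; exact: ball_open.
  by move=> l l' lrho lrho'; apply: lip; rewrite subr0.
- move=> x lam xr lrho; have [ET lL _] := main x lam xr lrho.
  by have [] := hGrepr _ _ ET lL.
- move=> lam lrho; have := xiP lam; rewrite !subr0 => /(_ lrho)[xir hxi].
  exact/(vanish_h _ _ xir lrho).
- move=> x lam xr lrho; rewrite vanish_h//; split=> [hx|->].
    by apply: uniq => //; rewrite subr0.
  by have := xiP lam; rewrite !subr0 => /(_ lrho)[].
Qed.
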